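(* Let $n \geq 4$, let $v_1 < v_2 < \cdots < v_n$ be positive integers, and let $L$ be a real number with $\mathrm{ML}(v_1,\ldots,v_{n-2}) \geq L$. If $$L \geq \frac{1}{n}\left(1 + \frac{3 v_{n-2}}{v_{n-1}}\right),$$ then $\mathrm{ML}(v_1,\ldots,v_n) \geq \frac{1}{n}$.
   Context: For real $x$, $\|x\|$ denotes the distance from $x$ to the nearest integer. For positive integers $v_1,\ldots,v_m$, the maximum loneliness is $\mathrm{ML}(v_1,\ldots,v_m) = \max_{t\in\mathbb{R}} \min_{1\le i\le m} \|t v_i\|$. *)

(* Defs.v *)
From HB Require Import structures.
From mathcomp Require Import all_boot all_order all_algebra.
From mathcomp Require Import all_classical all_reals all_analysis.
From mathcomp Require Import ring lra.

Set Implicit Arguments.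
Unset Strict Implicit.
Unset Printing Implicit Defensive.

Import Order.TTheory GRing.Theory Num.Theory.
Import numFieldNormedType.Exports.

Local Open Scope classical_set_scope.
Local Open Scope ring_scope.

Definition dist_int {R : realType} (x : R) : R :=
  inf [set `|x - k%:~R| | k in [set: int]].

(* Families v_1, ..., v_m are functions nat -> nat restricted to the indices
   1 <= i <= m.  The default value 1/2 only matters for m = 0: dist_int is
   bounded by 1/2 (dist_int_le_half). *)
Definition min_dist {R : realType} (v : nat -> nat) (m : nat) (t : R) : R :=
  \big[Num.min/2^-1]_(1 <= i < m.+1) dist_int (t * (v i)%:R).

(* The supremum is a maximum: see ML_max. *)
Definition ML (R : realType) (v : nat -> nat) (m : nat) : R :=
  sup (range (min_dist v m)).

Lemma dist_int_le {R : realType} (x : R) (k : int) :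
  dist_int x <= `|x - k%:~R|.
Proof.
apply: ge_inf; last by exists k.
by exists 0 => _ [j _ <-].
Qed.

Lemma dist_int_ge0 {R : realType} (x : R) : 0 <= dist_int x.
Proof.
apply: lb_le_inf; first by exists `|x - 0%:~R|, 0.
by move=> _ [j _ <-].
Qed.

Lemma dist_int_nearest {R : realType} (x : R) :
  exists k : int, dist_int x = `|x - k%:~R|.
Proof.
have := Num.Theory.floor_le x; have := floorD1_gt x.
set f := Num.floor x; rewrite intrD => h2 h1.
have key (j : int) : `|x - f%:~R| <= `|x - j%:~R| \/
                     `|x - (f + 1)%:~R| <= `|x - j%:~R|.
  have [jf|fj] := leP j f; [left|right].
  - have : (j%:~R : R) <= f%:~R by rewrite ler_int.
    by move=> ?; rewrite !ger0_norm; lra.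
  - have : ((f + 1)%:~R : R) <= j%:~R by rewrite ler_int lezD1.
    by rewrite intrD => ?; rewrite !ler0_norm ?intrD; lra.
have [h|h] := leP `|x - f%:~R| `|x - (f + 1)%:~R|.
- exists f; apply/eqP; rewrite eq_le dist_int_le /=.
  apply: lb_le_inf; first by exists `|x - 0%:~R|, 0.
  by move=> _ [j _ <-]; case: (key j) => // /(le_trans h).
- exists (f + 1); apply/eqP; rewrite eq_le dist_int_le /=.
  apply: lb_le_inf; first by exists `|x - 0%:~R|, 0.
  by move=> _ [j _ <-]; case: (key j) => // /(le_trans (ltW h)).
Qed.

Lemma dist_int_le_half {R : realType} (x : R) : dist_int x <= 2^-1.
Proof.
have := Num.Theory.floor_le x; have := floorD1_gt x.
set f := Num.floor x; rewrite intrD => h2 h1.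
have := dist_int_le x f; have := dist_int_le x (f + 1).
rewrite intrD ler0_norm; last lra.
by rewrite ger0_norm; lra.
Qed.

Lemma dist_intDz {R : realType} (x : R) (k : int) :
  dist_int (x + k%:~R) = dist_int x.
Proof.
apply/eqP; rewrite eq_le; apply/andP; split.
- have [j ->] := dist_int_nearest x.
  apply: le_trans (dist_int_le _ (j + k)) _.
  by rewrite intrD (_ : _ - _ = x - j%:~R) //; ring.
- have [j ->] := dist_int_nearest (x + k%:~R).
  apply: le_trans (dist_int_le _ (j - k)) _.
  by rewrite intrB (_ : x - _ = x + k%:~R - j%:~R) //; ring.
Qed.

Lemma dist_int_lip {R : realType} (x y : R) :
  dist_int x <= dist_int y + `|x - y|.
Proof.
have [j ->] := dist_int_nearest y.
apply: le_trans (dist_int_le _ j) _.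
rewrite (_ : x - j%:~R = (y - j%:~R) + (x - y)); last ring.
exact: ler_normD.
Qed.

Lemma continuous_dist_int {R : realType} : continuous (@dist_int R).
Proof.
move=> x; apply/cvgrPdist_le => e e0; near=> y.
have h : `|x - y| <= e by near: y; apply: cvgr_dist_le.
have := dist_int_lip x y; have := dist_int_lip y x.
by rewrite (distrC y x) ler_norml => h1 h2; apply/andP; split; lra.
Unshelve. all: by end_near. Qed.

Lemma continuous_min_dist {R : realType} (v : nat -> nat) (m : nat) :
  continuous (@min_dist R v m).
Proof.
rewrite /min_dist; elim: (index_iota 1 m.+1) => [|i s IH] x.
  under eq_fun do rewrite big_nil.
  exact: cvg_cst.
under eq_fun do rewrite big_cons.
apply: (@continuous_min R R (fun t => dist_int (t * (v i)%:R))); last exact: IH.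
apply: (@continuous_comp _ _ _ (fun t : R => t * (v i)%:R)).
  exact: mulrr_continuous.
exact: continuous_dist_int.
Qed.

Lemma min_distDz {R : realType} (v : nat -> nat) (m : nat) (t : R) (k : int) :
  min_dist v m (t + k%:~R) = min_dist v m t.
Proof.
apply: eq_bigr => i _.
by rewrite mulrDl -[(v i)%:R]/((v i)%:Z%:~R) -intrM dist_intDz.
Qed.

Lemma ML_max {R : realType} (v : nat -> nat) (m : nat) :
  exists2 t0 : R, ML R v m = min_dist v m t0 &
    forall t, min_dist v m t <= min_dist v m t0.
Proof.
have [c _ hc] := @EVT_max R (min_dist v m) 0 1 ler01
  (continuous_subspaceT (@continuous_min_dist R v m)).
have H t : min_dist v m t <= min_dist v m c.
  rewrite -(min_distDz v m t (- Num.floor t)); apply: hc.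
  rewrite in_itv /= intrN subr_ge0 Num.Theory.floor_le /=.
  by have := floorD1_gt t; rewrite intrD; lra.
exists c => //; apply/eqP; rewrite eq_le; apply/andP; split.
- by apply: ge_sup; [exists (min_dist v m 0), 0 | move=> _ [t _ <-]].
- apply: ub_le_sup; last by exists c.
  by exists (min_dist v m c) => _ [t _ <-].
Qed.

(* Main.v *)
Require Import Defs.
From mathcomp Require Import all_boot all_order all_algebra all_reals.
From mathcomp Require Import ring lra zify.

Import Order.TTheory GRing.Theory Num.Theory.
Local Open Scope ring_scope.

(** Put [d = 1 / n], and write [a < b < c] for the last three speeds.  At a
    time [t0] where the first [n - 2] runners are at distance at least [L] from
    the integers, moving the time by at most [3 * d / b] moves each of them by
    at most [3 * d * a / b <= L - d], so they stay at distance at least [d]. It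
    remains to find such a time that is also good for [b] and [c].

    In the coordinate [s = t * b] the allowed window is the interval of radius
    [3 * d] around [t0 * b].  The points at distance at least [d] from the
    integers form intervals of length [1 - 2 * d], which is at least [2 * d]
    because [n >= 4], separated by gaps of length [2 * d]; hence the window
    contains a whole interval of length [2 * d] of such points
    ([good_interval_near]).  While [s] runs through it, the runner of speed
    [c > b] covers a length of at least [2 * d], which is too much to remain
    within distance less than [d] of a single integer ([good_point_after]). *)

Lemma dist_int_ge {R : realType} (x d : R) (k : int) :
  k%:~R + d <= x -> x <= k%:~R + 1 - d -> d <= dist_int x.
Proof.
move=> kdx xkd; have [j ->] := dist_int_nearest x.
have [jk|kj] := leP j k.
- have : (j%:~R : R) <= k%:~R by rewrite ler_int.
  by move=> ?; apply: le_trans (ler_norm _); lra.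
- have : ((k + 1)%:~R : R) <= j%:~R by rewrite ler_int lezD1.
  by rewrite intrD distrC => ?; apply: le_trans (ler_norm _); lra.
Qed.

(** If [y] itself is too close to the integer [k], then [k + d] lies in the
    interval. *)
Lemma good_point_after {R : realType} (d y : R) :
  0 <= d -> d <= 2^-1 -> exists2 z : R, y <= z <= y + 2 * d & d <= dist_int z.
Proof.
move=> d_ge0 d_le; have [y_good|] := leP d (dist_int y).
  by exists y => //; lra.
have [k ->] := dist_int_nearest y; rewrite ltr_norml => /andP[y_gt y_lt].
by exists (k%:~R + d); [lra | apply: (@dist_int_ge _ _ _ k); lra].
Qed.

(** The radius [3 * d] is what the worst case asks for: if [s0] is an integer,
    a distance [d] is lost in leaving its neighbourhood, and an interval of
    length [2 * d] starts only there. *)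
Lemma good_interval_near {R : realType} (d s0 : R) : 0 <= d -> d <= 4^-1 ->
  exists2 p : R, s0 - 3 * d <= p <= s0 + d &
    forall s, p <= s <= p + 2 * d -> d <= dist_int s.
Proof.
move=> d_ge0 d_le.
have := Num.Theory.floor_le s0; have := floorD1_gt s0.
set f := Num.floor s0; rewrite intrD => s0_lt s0_ge.
(* The interval centred at s0, pushed into [f + d, f + 1 - d]. *)
exists (Num.min (Num.max (f%:~R + d) (s0 - d)) (f%:~R + 1 - 3 * d)).
  by rewrite le_min le_max ge_min ge_max; apply/andP; split; lra.
move=> s /andP[]; rewrite ge_min ge_max -lerBlDr le_min le_max => s_ge.
move=> s_le; apply: (@dist_int_ge _ _ _ f); lra.
Qed.

Lemma good_time_for_two {R : realType} (d b c t0 : R) :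
  0 <= d -> d <= 4^-1 -> 0 < b -> b <= c ->
  exists2 t : R, `|t0 - t| <= 3 * d / b &
    d <= dist_int (t * b) /\ d <= dist_int (t * c).
Proof.
move=> d_ge0 d_le b_gt0 b_le_c; have c_gt0 := lt_le_trans b_gt0 b_le_c.
have [p p_near p_good] := good_interval_near d (t0 * b) d_ge0 d_le.
(* As t * b runs through [p, p + 2 * d], t * c starts from p / b * c. *)
have d_le2 : d <= 2^-1 by lra.
have [z /andP[z_ge z_le] z_good] := good_point_after d (p / b * c) d_ge0 d_le2.
have tb_in : p <= z / c * b <= p + 2 * d.
  rewrite mulrAC ler_pdivlMr // ler_pdivrMr //; apply/andP; split.
    by move: z_ge; rewrite mulrAC ler_pdivrMr.
  have : z * b <= (p / b * c + 2 * d) * b by rewrite ler_pM2r.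
  have -> : (p / b * c + 2 * d) * b = p * c + 2 * d * b.
    by field; rewrite lt0r_neq0.
  have : 2 * d * b <= 2 * d * c by rewrite ler_wpM2l //; lra.
  by rewrite [X in _ -> _ -> _ <= X]mulrDl; lra.
exists (z / c); last first.
  by rewrite (divfK (lt0r_neq0 c_gt0)); split=> //; apply: p_good.
rewrite ler_pdivlMr // -[X in _ * X <= _](gtr0_norm b_gt0) -normrM mulrBl.
rewrite ler_norml.
move/andP: tb_in => [? ?]; move/andP: p_near => [? ?].
by apply/andP; split; lra.
Qed.

Lemma le_min_distP {R : realType} (v : nat -> nat) (m : nat) (d t : R) :
  reflect (d <= 2^-1 /\
    forall i, (1 <= i <= m)%N -> d <= dist_int (t * (v i)%:R))
    (d <= min_dist v m t).
Proof.
rewrite /min_dist.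
have -> F : (d <= \big[Num.min/2^-1]_(1 <= i < m.+1) F i) =
    (d <= 2^-1) && all (fun i => d <= F i) (index_iota 1 m.+1).
  elim: (index_iota 1 m.+1) => [|i s IHs]; first by rewrite big_nil andbT.
  by rewrite big_cons le_min IHs /= andbCA.
apply: (iffP andP) => [[? /allP d_le]|[? d_le]]; split=> //.
- by move=> i i_in; apply: d_le; rewrite mem_index_iota ltnS.
- by apply/allP => i; rewrite mem_index_iota ltnS => /d_le.
Qed.

Theorem lemma3p4 (R : realType) (n : nat) (v : nat -> nat) (L : R)
  (n_ge4 : (4 <= n)%N)
  (v_gt0 : forall i : nat, (1 <= i <= n)%N -> (0 < v i)%N)
  (v_incr : forall i j : nat, (1 <= i)%N -> (i < j)%N -> (j <= n)%N ->
    (v i < v j)%N)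
  (L_le_ML : L <= ML R v (n - 2))
  (L_ge : 1 / n%:R * (1 + 3 * (v (n - 2)%N)%:R / (v (n - 1)%N)%:R) <= L) :
  1 / n%:R <= ML R v n.
Proof.
set a : R := (v (n - 2)%N)%:R in L_ge; set b : R := (v (n - 1)%N)%:R in L_ge.
have b_gt0 : 0 < b by rewrite ltr0n v_gt0 //; lia.
have b_le_c : b <= (v n)%:R by rewrite ler_nat ltnW // v_incr //; lia.
set d : R := 1 / n%:R in L_ge *.
have d_ge0 : 0 <= d by rewrite divr_ge0.
have d_le : d <= 4^-1.
  by rewrite /d div1r lef_pV2 ?posrE ?ltr0n ?ler_nat //; lia.
have [t0 ML_t0 _] := ML_max v (n - 2) (R := R).
have /le_min_distP[_ t0_good] : L <= min_dist v (n - 2) t0 by rewrite -ML_t0.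
have [t t_near [tb_good tc_good]] :=
  good_time_for_two d b _ t0 d_ge0 d_le b_gt0 b_le_c.
have [tmax -> /(_ t)] := ML_max v n (R := R); apply: le_trans.
apply/le_min_distP; split=> [|i /andP[i_ge1 i_le]]; first by lra.
have [->|i_neq_n] := eqVneq i n; first by [].
have [->|i_neq_n1] := eqVneq i (n - 1)%N; first by [].
have i_le2 : (i <= n - 2)%N by lia.
have vi_le : (v i)%:R <= a.
  rewrite ler_nat; have [->//|i_neq] := eqVneq i (n - 2)%N.
  by rewrite ltnW // v_incr //; lia.
have := dist_int_lip (t0 * (v i)%:R) (t * (v i)%:R).
rewrite -mulrBl normrM (ger0_norm (ler0n R (v i))).
have : L <= dist_int (t0 * (v i)%:R) by apply: t0_good; rewrite i_ge1.
have : `|t0 - t| * (v i)%:R <= 3 * d / b * a by apply: ler_pM.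
have : d * (1 + 3 * a / b) = d + 3 * d / b * a by ring.
lra.
Qed.
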